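(* Let $\mathcal{A}\subseteq\mathcal{X}$ be such that a) $\mathcal{A}+\mathcal{R}(B)^{\succ}\subseteq\mathcal{A}$ for all $B\in\mathcal{B}^{\varnothing}$; b) $\mathcal{R}(B)^{\prec}\cap\mathcal{A}=\emptyset$ for all $B\in\mathcal{B}^{\varnothing}$. Define, for all $X|B\in\mathcal{D}_{LIN}$, $$\underline{P}(X|B)=\sup\{x\in\mathbb{R}:B(X-x)\in\mathcal{A}\}.$$ Then: 1) $\underline{P}$ is $2$-convex on $\mathcal{D}_{LIN}$; 2) $\underline{P}$ is centered if and only if $\mathcal{R}(B)^{\succ}\subseteq\mathcal{A}$ for all $B\in\mathcal{B}^{\varnothing}$.
   Context: Fix a partition $\mathbb{P}$ of the sure event $\Omega$ into atoms $\omega$. A gamble is a bounded function $X:\mathbb{P}\to\mathbb{R}$. Events are subsets of $\mathbb{P}$, identified with their indicators; $\wedge,\vee,\neg$ denote intersection, union, complement; $\varnothing$ is the impossible event. For a gamble $X$ and an event $B\neq\varnothing$, the conditional gamble $X|B$ is the restriction of $X$ to $B$; thus $\sup\{X|B\}=\sup_{\omega\in B}X(\omega)$ and $\inf\{X|B\}=\inf_{\omega\in B}X(\omega)$. Let $\mathcal{X}$ be a linear space of gambles and $\mathcal{B}\subset\mathcal{X}$ a set of (indicators of) events, with $\Omega\in\mathcal{B}$ and $BX\in\mathcal{X}$ for all $B\in\mathcal{B}$, $X\in\mathcal{X}$. Put $\mathcal{B}^{\varnothing}=\mathcal{B}\setminus\{\varnothing\}$ and $\mathcal{D}_{LIN}=\{X|B: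 X\in\mathcal{X}, B\in\mathcal{B}^{\varnothing}\}$. For $B\in\mathcal{B}^{\varnothing}$ let $\mathcal{R}(B)=\{X\in\mathcal{X}:BX=X\}$, $\mathcal{R}(B)^{\succ}=\{X\in\mathcal{R}(B):\inf\{X|B\}>0\}$, $\mathcal{R}(B)^{\prec}=\{X\in\mathcal{R}(B):\sup\{X|B\}<0\}$. Sums of sets are Minkowski sums: $\mathcal{S}+\mathcal{T}=\{X+Y:X\in\mathcal{S},Y\in\mathcal{T}\}$. $\underline{P}:\mathcal{D}\to\mathbb{R}$ is $2$-convex on $\mathcal{D}$ iff for all $X_0|B_0,X_1|B_1\in\mathcal{D}$, $\sup\{B_1(X_1-\underline{P}(X_1|B_1))-B_0(X_0-\underline{P}(X_0|B_0))\,|\,B_0\vee B_1\}\geq 0$. It is centered iff for every $X|B\in\mathcal{D}$, $0|B\in\mathcal{D}$ and $\underline{P}(0|B)=0$.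
   Formalization: Part 1) is stated under the added assumption that the lower prevision is real-valued on D_LIN; a) and b) do not ensure this (for the empty set A they hold, but every supremum is −∞, so 2-convexity is undefined). *)

(* Defs.v *)
(* MathComp-Analysis, over an arbitrary R : realType. *)
From mathcomp Require Import all_boot all_order all_algebra.
From mathcomp Require Import all_classical all_reals all_analysis.
Set Implicit Arguments.
Unset Strict Implicit.
Unset Printing Implicit Defensive.
Import Order.TTheory GRing.Theory Num.Theory.
Import numFieldNormedType.Exports.
Local Open Scope classical_set_scope.
Local Open Scope ring_scope.

Section Defs.
Variables (R : realType) (T : Type).
(* The atoms of the partition are the elements of T; an event is a set of
   atoms, and its indicator is \1_B.  Algebraic operations on T -> R are
   pointwise. *)
Implicit Types (X Y : T -> R) (A : set (T -> R)) (B : set T).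

(* sup {X | B} and inf {X | B}; finite when X is bounded and B nonempty. *)
Definition cond_sup X B : \bar R := ereal_sup [set (X w)%:E | w in B].
Definition cond_inf X B : \bar R := ereal_inf [set (X w)%:E | w in B].

Definition gamble_setting (Xs : set (T -> R)) (Bs : set (set T)) : Prop :=
  [/\ forall X, Xs X -> bounded_fun X,
      submod_closed [in Xs],
      forall B, Bs B -> Xs \1_B,
      Bs [set: T] &
      forall B X, Bs B -> Xs X -> Xs (\1_B * X)].

Definition nonempty_events (Bs : set (set T)) : set (set T) :=
  [set B | Bs B /\ B <> set0].

(* A conditional gamble X|B is represented by the pair (X, B); [lower_prev]
   below depends on X only through its restriction to B. *)
Definition D_LIN (Xs : set (T -> R)) (Bs : set (set T)) :
    set ((T -> R) * set T) :=
  Xs `*` nonempty_events Bs.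

Definition R_on (Xs : set (T -> R)) B : set (T -> R) :=
  [set X | Xs X /\ \1_B * X = X].

Definition R_pos (Xs : set (T -> R)) B : set (T -> R) :=
  [set X | R_on Xs B X /\ (0 < cond_inf X B)%E].

Definition R_neg (Xs : set (T -> R)) B : set (T -> R) :=
  [set X | R_on Xs B X /\ (cond_sup X B < 0)%E].

Definition set_sum (S U : set (T -> R)) : set (T -> R) :=
  [set X + Y | X in S & Y in U].

(* The supremum is taken in \bar R: it is -oo when no x is acceptable. *)
Definition lower_prev A X B : \bar R :=
  ereal_sup [set x%:E | x in [set x : R | A (\1_B * (X - cst x))]].

Section Consistency.
Variables (D : set ((T -> R) * set T)) (P : (T -> R) -> set T -> \bar R).

Definition real_valued_on : Prop :=
  forall X B, D (X, B) -> P X B \is a fin_num.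

(* 2-convexity and centering are notions for real-valued maps, hence the
   first conjuncts; under them [fine] is faithful. *)
Definition two_convex : Prop :=
  real_valued_on /\
  forall X0 B0 X1 B1, D (X0, B0) -> D (X1, B1) ->
    (0 <= cond_sup (\1_B1 * (X1 - cst (fine (P X1 B1)))
                    - \1_B0 * (X0 - cst (fine (P X0 B0))))%R
                   (B0 `|` B1))%E.

Definition centered : Prop :=
  real_valued_on /\
  forall X B, D (X, B) -> D (0 : T -> R, B) /\ P 0 B = 0%E.

End Consistency.

End Defs.

(* Main.v *)
(* If the supremum in the definition of 2-convexity were negative, then
   Z := B0 (X0 - y) - B1 (X1 - x) would be bounded below by some c > 0 on
   B0 \/ B1 for some y > P(X0|B0) and some x with B1 (X1 - x) in A.  The event
   B0 \/ B1 need not belong to Bs, so (a) cannot be applied to it; instead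
   Z = (B0 Z - B0 B1 Z / 2) + (B1 Z - B0 B1 Z / 2) splits Z into elements of
   R(B0)^> and R(B1)^>, and applying (a) twice gives B0 (X0 - y) in A, which
   contradicts y > P(X0|B0). *)
Require Import Defs.
From mathcomp Require Import all_boot all_order all_algebra.
From mathcomp Require Import all_classical all_reals all_analysis.
From mathcomp Require Import ring lra.
Import Order.TTheory GRing.Theory Num.Theory.
Import numFieldNormedType.Exports.
Local Open Scope classical_set_scope.
Local Open Scope ring_scope.

(** * Strict signs of conditional bounds, and products with indicators *)

Section CondBounds.
Context {R : realType} {T : Type}.
Implicit Types (X Y : T -> R) (B : set T).

Lemma cond_inf_gt0P X B :
  (0 < cond_inf X B)%E <-> exists2 d : R, 0 < d & forall w, B w -> d <= X w.
Proof.
split=> [inf_gt0|[d d0 dX]]; last first.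
  apply: (@lt_le_trans _ _ d%:E); first by rewrite lte_fin.
  by apply: le_ereal_inf_tmp => _ [w Bw <-]; rewrite lee_fin dX.
have infX w : B w -> (cond_inf X B <= (X w)%:E)%E.
  by move=> Bw; apply: ereal_inf_lbound; exists w.
case: (cond_inf X B) inf_gt0 infX => [r| |] // r0 infX.
  by exists r => // w /infX.
(* An infimum equal to [+oo] forces [B] to be empty, so any positive bound serves. *)
by exists 1 => // w /infX.
Qed.

Lemma cond_sup_lt0P X B :
  (cond_sup X B < 0)%E <-> exists2 d : R, 0 < d & forall w, B w -> X w <= - d.
Proof.
split=> [sup_lt0|[d d0 dX]]; last first.
  apply: (@le_lt_trans _ _ (- d)%:E); last by rewrite lte_fin oppr_lt0.
  by apply: ge_ereal_sup => _ [w Bw <-]; rewrite lee_fin dX.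
have supX w : B w -> ((X w)%:E <= cond_sup X B)%E.
  by move=> Bw; apply: ereal_sup_ubound; exists w.
case: (cond_sup X B) sup_lt0 supX => [r| |] // r0 supX.
  by exists (- r) => [|w /supX]; rewrite ?oppr_gt0 // opprK.
by exists 1 => // w /supX.
Qed.

Lemma subrfctE X Y w : (X - Y) w = X w - Y w.
Proof. by []. Qed.

Lemma indicM0 X B w : ~ B w -> (\1_B * X) w = 0.
Proof. by move=> nBw; rewrite fctE indicE memNset // mul0r. Qed.

Lemma indicM1 X B w : B w -> (\1_B * X) w = X w.
Proof. by move=> Bw; rewrite fctE indicE mem_set // mul1r. Qed.

Lemma indicM_id X B : (forall w, ~ B w -> X w = 0) -> \1_B * X = X.
Proof.
move=> X0; apply/funext => w.
have [Bw|nBw] := pselect (B w); first exact: indicM1.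
by rewrite indicM0 // X0.
Qed.

End CondBounds.

(** * Closure properties of the space of gambles *)

Section Acceptability.
Context {R : realType} {T : Type} {Xs : set (T -> R)} {Bs : set (set T)}.
Hypothesis setting : gamble_setting Xs Bs.
Implicit Types (X Y : T -> R) (B : set T).

Lemma setting0 : Xs 0.
Proof. by case: setting => _ [/set_mem]. Qed.

Lemma settingP a X Y : Xs X -> Xs Y -> Xs (a *: X + Y).
Proof.
case: setting => _ [_ lin] _ _ _ XsX XsY.
by apply: set_mem; apply: lin; apply: mem_set.
Qed.

Lemma settingZ a X : Xs X -> Xs (a *: X).
Proof. by move=> XsX; rewrite -[_ *: _]addr0; apply: settingP setting0. Qed.

Lemma settingB X Y : Xs X -> Xs Y -> Xs (X - Y).
Proof. by move=> XsX XsY; rewrite addrC -scaleN1r; apply: settingP. Qed.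

Lemma setting_cst a : Xs (cst a).
Proof.
case: setting => _ _ ind setT_ev _.
(* Constants are gambles of [Xs] because the sure event is in [Bs]. *)
have -> : cst a = a *: (\1_[set: T] : T -> R).
  by apply/funext => w; rewrite scalrfctE indicT; exact: esym (mulr1 a).
exact/settingZ/ind.
Qed.

Lemma setting_indicM B X : Bs B -> Xs X -> Xs (\1_B * X).
Proof. by case: setting => _ _ _ _; apply. Qed.

Lemma setting_shift B X x : Bs B -> Xs X -> Xs (\1_B * (X - cst x)).
Proof.
by move=> evB XsX; apply: setting_indicM => //; apply/settingB/setting_cst.
Qed.

Lemma R_posI X B d : Xs X -> (forall w, ~ B w -> X w = 0) ->
  0 < d -> (forall w, B w -> d <= X w) -> R_pos Xs B X.
Proof.
move=> XsX X0 d0 dX; split; last by apply/cond_inf_gt0P; exists d.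
by split => //; apply: indicM_id.
Qed.

Lemma R_negI X B d : Xs X -> (forall w, ~ B w -> X w = 0) ->
  0 < d -> (forall w, B w -> X w <= - d) -> R_neg Xs B X.
Proof.
move=> XsX X0 d0 dX; split; last by apply/cond_sup_lt0P; exists d.
by split => //; apply: indicM_id.
Qed.

Lemma setting_bounded X : Xs X -> exists M, forall w, `|X w| <= M.
Proof.
case: setting => bnd _ _ _ _ /bnd [M [_ XM]].
(* Boundedness supplies only bounds strictly above [M], hence [M + 1]. *)
by exists (M + 1) => w; apply: XM => //; rewrite ltrDl.
Qed.

(** * Bounds on the lower prevision *)

Context {A : set (T -> R)}.

Lemma accept_le_lower_prev X B x :
  A (\1_B * (X - cst x)) -> (x%:E <= lower_prev A X B)%E.
Proof. by move=> Ax; apply: ereal_sup_ubound; exists x. Qed.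

Lemma lower_prev_approx X B y : (y%:E < lower_prev A X B)%E ->
  exists2 x, y < x & A (\1_B * (X - cst x)).
Proof.
by move=> /ereal_sup_gt[_ [x Ax <-]]; rewrite lte_fin => yx; exists x.
Qed.

Hypothesis A_neg : forall B, nonempty_events Bs B -> R_neg Xs B `&` A = set0.

(** If [x > M], the gamble [B (X - x)] is at most [- (x - M)] on [B], so it lies in [R_neg Xs B] and
    (b) excludes it from [A]. *)
Lemma accept_le_bound X B M x : nonempty_events Bs B -> Xs X ->
  (forall w, B w -> X w <= M) -> A (\1_B * (X - cst x)) -> x <= M.
Proof.
move=> evB XsX XM Ax; rewrite leNgt; apply/negP => Mx.
suff : (R_neg Xs B `&` A) (\1_B * (X - cst x)) by rewrite A_neg.
split=> //; apply: (@R_negI _ _ (x - M)).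
- by apply: setting_shift => //; case: evB.
- by move=> w; exact: indicM0.
- by rewrite subr_gt0.
- by move=> w Bw; rewrite indicM1 // opprB lerB // XM.
Qed.

Lemma lower_prev_le_bound X B M : nonempty_events Bs B -> Xs X ->
  (forall w, B w -> X w <= M) -> (lower_prev A X B <= M%:E)%E.
Proof.
move=> evB XsX XM; apply: ge_ereal_sup => _ [x Ax <-].
by rewrite lee_fin; apply: accept_le_bound Ax.
Qed.

(** For every [e > 0], the gamble [B (X - (m - e))] is at least [e] on [B], hence in [A]. The value
    [m] itself may fail to be acceptable, so it is only approached from below. *)
Lemma bound_le_lower_prev X B m : R_pos Xs B `<=` A ->
  nonempty_events Bs B -> Xs X ->
  (forall w, B w -> m <= X w) -> (m%:E <= lower_prev A X B)%E.
Proof.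
move=> posA [evB _] XsX mX; apply/lee_addgt0Pr => e e0.
rewrite -leeBlDr // -EFinB; apply: accept_le_lower_prev; apply: posA.
apply: (@R_posI _ _ e) => //.
- exact: setting_shift.
- by move=> w; exact: indicM0.
- move=> w Bw; rewrite indicM1 //.
  by have := mX w Bw; rewrite !fctE => ?; lra.
Qed.

(** * Enlarging acceptable gambles: 2-convexity and centering *)

Hypothesis A_pos :
  forall B, nonempty_events Bs B -> set_sum A (R_pos Xs B) `<=` A.

Lemma accept_add_union X Z B0 B1 (c : R) :
  nonempty_events Bs B0 -> nonempty_events Bs B1 -> A X -> Xs Z ->
  (forall w, ~ (B0 `|` B1) w -> Z w = 0) ->
  0 < c -> (forall w, (B0 `|` B1) w -> c <= Z w) -> A (X + Z).
Proof.
move=> ev0 ev1 AX XsZ Z0 c0 cZ.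
have [Bs0 _] := ev0; have [Bs1 _] := ev1.
(* [H] is half of [Z] on the intersection of the two events and zero elsewhere. Multiplying by one
   indicator at a time keeps it in [Xs] without the intersection being in [Bs]. *)
pose H : T -> R := 2^-1 *: (\1_B0 * (\1_B1 * Z)).
have XsH : Xs H by apply: settingZ; do 2![apply: setting_indicM => //].
have HE w : H w = 2^-1 * (\1_B0 w * (\1_B1 w * Z w)) by [].
(* On [B] the part equals [Z] outside the other event and [Z / 2] inside it, hence the bound
   [c / 2]. *)
have part_pos B : Bs B -> (B = B0) \/ (B = B1) -> R_pos Xs B (\1_B * Z - H).
  move=> BsB BE; apply: (@R_posI _ _ (c / 2)).
  - by apply: settingB => //; apply: setting_indicM.
  - move=> w nBw; rewrite subrfctE indicM0 // HE !indicE.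
    by case: BE nBw => -> nBw; rewrite (memNset nBw) !(mul0r, mulr0) subr0.
  - by rewrite divr_gt0.
  - move=> w Bw; rewrite subrfctE indicM1 // HE !indicE.
    have cw : c <= Z w by apply: cZ; case: BE Bw => ->; [left|right].
    by case: (w \in B0); case: (w \in B1); rewrite /=; lra.
have -> : X + Z = (X + (\1_B0 * Z - H)) + (\1_B1 * Z - H).
  apply/funext => w; rewrite !(addrfctE, opprfctE) HE !mulrfctE !indicE.
  have [B0w|nB0w] := pselect (B0 w); have [B1w|nB1w] := pselect (B1 w);
    rewrite ?(mem_set B0w) ?(memNset nB0w) ?(mem_set B1w) ?(memNset nB1w) /=;
    try by field.
  by rewrite Z0; [field | case].
apply: (A_pos _ ev1); exists (X + (\1_B0 * Z - H)); last first.
  by exists (\1_B1 * Z - H) => //; apply: part_pos => //; right.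
apply: (A_pos _ ev0); exists X => //.
by exists (\1_B0 * Z - H) => //; apply: part_pos => //; left.
Qed.

(** Finiteness is assumed because (a) and (b) hold for an empty [A], for which every supremum is
    [-oo]. *)
Lemma lower_prev_two_convex :
  real_valued_on (D_LIN Xs Bs) (lower_prev A) ->
  two_convex (D_LIN Xs Bs) (lower_prev A).
Proof.
move=> rv; split=> // X0 B0 X1 B1 D0 D1.
have := rv _ _ D0; have := rv _ _ D1.
case: D0 => /= XsX0 ev0; case: D1 => /= XsX1 ev1 fin1 fin0.
set p1 := fine (lower_prev A X1 B1); set p0 := fine (lower_prev A X0 B0).
have p1E : lower_prev A X1 B1 = p1%:E by rewrite fineK.
have p0E : lower_prev A X0 B0 = p0%:E by rewrite fineK.
rewrite leNgt; apply/negP => /cond_sup_lt0P[d d0 dX].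
(* Replacing [p1] by [x] and [p0] by [y] costs at most [d / 4] each, so the gap [d] shrinks to no
   less than [d / 2]. *)
have [|x p1x Ax] := @lower_prev_approx X1 B1 (p1 - d / 4).
  by rewrite p1E lte_fin; lra.
have xp1 : x <= p1 by rewrite -lee_fin -p1E; exact: accept_le_lower_prev.
pose y := p0 + d / 4.
suff : A (\1_B0 * (X0 - cst y)).
  by move=> /accept_le_lower_prev; rewrite p0E lee_fin /y; lra.
rewrite -[\1_B0 * _](subrK (\1_B1 * (X1 - cst x))) addrC.
apply: (@accept_add_union _ _ B0 B1 (d / 2)) => //.
- by apply: settingB; apply: setting_shift => //; [case: ev0|case: ev1].
- move=> w nBw; rewrite subrfctE !indicM0 ?subr0 // => Bw.
    by apply: nBw; right.
  by apply: nBw; left.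
- by rewrite divr_gt0.
- move=> w /dX; rewrite /y !fctE !indicE.
  (* If [w] is in neither event, the bound taken from [dX] reads [0 <= - d], which is absurd. *)
  by case: (w \in B0); case: (w \in B1); rewrite /= ?mul0r ?mul1r; lra.
Qed.

(** The prevision of [X] given [B] lies between any lower and upper bounds of [X] on [B]: bounds
    [- M] and [M] give finiteness, and the bounds 0 of the zero gamble give the value 0. *)
Lemma lower_prev_centered :
  (forall B, nonempty_events Bs B -> R_pos Xs B `<=` A) ->
  centered (D_LIN Xs Bs) (lower_prev A).
Proof.
move=> posA; split=> X B [/= XsX evB].
  have [M XM] := @setting_bounded X XsX.
  have leM : (lower_prev A X B <= M%:E)%E.
    apply: lower_prev_le_bound => // w _.
    exact: le_trans (ler_norm _) (XM w).
  have geM : ((- M)%:E <= lower_prev A X B)%E.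
    apply: bound_le_lower_prev => // [|w _]; first exact: posA.
    by have := XM w; rewrite ler_norml => /andP[].
  by rewrite fin_real // (lt_le_trans (ltNyr _) geM) (le_lt_trans leM (ltry _)).
split; first by split=> //; exact: setting0.
apply/le_anti/andP; split.
  by apply: lower_prev_le_bound => //; exact: setting0.
by apply: bound_le_lower_prev => //; [exact: posA|exact: setting0].
Qed.

(** The value 0 at the zero gamble makes [- x B] acceptable for some [x > - d], where [d] bounds [X]
    below on [B]. Then [X + x B] is at least [d + x > 0] on [B], and (a) adds it to [- x B] to
    recover [X]. *)
Lemma centered_R_pos_sub B : centered (D_LIN Xs Bs) (lower_prev A) ->
  nonempty_events Bs B -> R_pos Xs B `<=` A.
Proof.
move=> [_ ctr] evB X [[XsX BX] /cond_inf_gt0P[d d0 dX]].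
have [_ P0] := ctr 0 B (conj setting0 evB).
have [|x dx Ax] := @lower_prev_approx 0 B (- d).
  by rewrite P0 lte_fin oppr_lt0.
have XsS : Xs (\1_B * (0 - cst x)).
  by apply: setting_shift setting0; case: evB.
rewrite -[X](subrK (\1_B * (0 - cst x))) addrC.
apply: (A_pos _ evB); exists (\1_B * (0 - cst x)) => //.
exists (X - \1_B * (0 - cst x)) => //; apply: (@R_posI _ _ (d + x)).
- exact: settingB.
- move=> w nBw; rewrite subrfctE indicM0 // subr0.
  by rewrite -BX indicM0.
- lra.
- move=> w Bw; have := dX w Bw.
  by rewrite subrfctE indicM1 // (_ : (0 - cst x) w = 0 - x) //; lra.
Qed.

End Acceptability.

Theorem proposition19 (R : realType) (T : Type)
    (Xs : set (T -> R)) (Bs : set (set T)) (A : set (T -> R))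
    (setting : gamble_setting Xs Bs)
    (A_sub : A `<=` Xs)
    (A_pos : forall B, nonempty_events Bs B ->
       set_sum A (R_pos Xs B) `<=` A)
    (A_neg : forall B, nonempty_events Bs B ->
       R_neg Xs B `&` A = set0) :
  (real_valued_on (D_LIN Xs Bs) (lower_prev A) ->
     two_convex (D_LIN Xs Bs) (lower_prev A))
  /\
  (centered (D_LIN Xs Bs) (lower_prev A) <->
     forall B, nonempty_events Bs B -> R_pos Xs B `<=` A).
Proof.
split; first exact: lower_prev_two_convex.
split=> [ctr B|]; last exact: lower_prev_centered.
exact: centered_R_pos_sub.
Qed.
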